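(* Let $G$ be a finite group with identity element $e$ and let $V$ be an $n$-dimensional real $G$-representation. Let $X$ be an $n$-dimensional simplicial set with a simplicial action of $G$. Assume that 1. for every face $\sigma$ of $X$ and every $g\in G$ with $g\neq e$, the intersection $\sigma\cap g\sigma$ is empty; 2. the image of every $G$-equivariant (continuous) map $X\to V$ contains the origin of $V$. Then $X$ has at least $2^n$ $G$-orbits of faces of dimension $n$.
   Context: A face of dimension $k$ of a simplicial set $X$ is a non-degenerate $k$-simplex of $X$. When a face $\sigma$ is regarded as a subset (as in the intersection $\sigma\cap g\sigma$), it means the closed face: the image of the closed standard simplex $\Delta^k$ in the geometric realization $|X|$ under the characteristic map of $\sigma$. The vertices of a face may coincide in $X$, so a closed face need not be an embedded simplex. $X$ is $n$-dimensional when it has no faces of dimension greater than $n$. A simplicial action of $G$ on $X$ is an action by automorphisms of the simplicial set; it induces an action on the geometric realization and on the set of faces of each dimension. Maps $X\to V$ are continuous maps from the geometric realization $|X|$ to $V$. *)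

(* Defs.v *)
From HB Require Import structures.
From mathcomp Require Import all_boot all_order all_algebra all_fingroup.
From mathcomp Require Import mxrepresentation.
From mathcomp Require Import all_classical all_reals all_analysis.
From mathcomp Require Import generic_quotient.
From Stdlib Require Import Relation_Operators.

Set Implicit Arguments.
Unset Strict Implicit.
Unset Printing Implicit Defensive.

Import Order.TTheory GRing.Theory Num.Theory.
Import numFieldNormedType.Exports.
Local Open Scope classical_set_scope.
Local Open Scope ring_scope.
Local Open Scope quotient_scope.

(* The simplex category: [n] is the ordinal 'I_n.+1 with its usual order, and
   the morphisms are all nondecreasing maps. *)
Notation "''Delta' ( m , n )" := {omorphism 'I_m.+1 -> 'I_n.+1}
  (at level 8, format "''Delta' ( m ,  n )").

(* A contravariant functor from the simplex category to sets.  Functoriality is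
   stated through values so that it does not depend on the proof of monotonicity
   carried by a morphism. *)
Record sset := SSet {
  simplices :> nat -> choiceType;
  sset_map : forall m n, 'Delta(m, n) -> simplices n -> simplices m;
  sset_map_id : forall n (f : 'Delta(n, n)) (x : simplices n),
    f =1 id -> sset_map f x = x;
  sset_map_comp : forall l m n (f : 'Delta(l, m)) (g : 'Delta(m, n))
      (h : 'Delta(l, n)) (x : simplices n),
    h =1 g \o f -> sset_map h x = sset_map f (sset_map g x) }.

Definition degenerate (X : sset) n (x : X n) : Prop :=
  exists m (f : 'Delta(n, m)) (y : X m),
    [/\ (m < n)%N, (forall j, exists i, f i = j) & x = sset_map f y].

Definition faces (X : sset) n : set (X n) := [set x | ~ degenerate x].
Arguments faces X n : clear implicits.

Definition sset_dim_le (X : sset) n : Prop :=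
  forall k, (n < k)%N -> faces X k = set0.

Definition stdsimplex (R : realType) n : set 'rV[R]_n.+1 :=
  [set t | (forall i, 0 <= t 0 i) /\ \sum_i t 0 i = 1].
Arguments stdsimplex R n : clear implicits.

Section StdSimplexMap.
Variables (R : realType) (m n : nat) (f : 'Delta(m, n)).

(* The affine map sending the i-th vertex to the (f i)-th vertex. *)
Definition vertex_map (t : 'rV[R]_m.+1) : 'rV[R]_n.+1 :=
  \row_j \sum_(i | f i == j) t 0 i.

Lemma vertex_map_stdsimplex t :
  stdsimplex R m t -> stdsimplex R n (vertex_map t).
Proof.
move=> [t0 t1]; split=> [j|]; first by rewrite mxE; apply: sumr_ge0.
rewrite -t1 (partition_big f xpredT) //=.
by apply: eq_bigr => j _; rewrite mxE.
Qed.

Definition stdsimplex_map (t : stdsimplex R m) : stdsimplex R n :=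
  SigSub (mem_set (vertex_map_stdsimplex (set_valP t))).

End StdSimplexMap.

Section Realization.
Variables (R : realType) (X : sset).

(* The coproduct of one copy of the standard k-simplex for each x in X k. *)
Definition prerealization : topologicalType :=
  {s : {k & X k} & stdsimplex R (tag s)}.

Definition pre_point k (x : X k) (t : stdsimplex R k) : prerealization :=
  existT (fun s : {k & X k} => stdsimplex R (tag s)) (existT _ k x) t.

Inductive glue : prerealization -> prerealization -> Prop :=
  Glue m n (f : 'Delta(m, n)) (x : X n) (t : stdsimplex R m) :
    glue (pre_point (sset_map f x) t) (pre_point x (stdsimplex_map f t)).

Definition glue_eq (u v : prerealization) : bool :=
  `[< clos_refl_sym_trans _ glue u v >].

Lemma glue_eq_refl : reflexive glue_eq.
Proof. by move=> u; apply/asboolP; exact: rst_refl. Qed.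

Lemma glue_eq_sym : symmetric glue_eq.
Proof. by move=> u v; apply/asboolP/asboolP => ?; exact: rst_sym. Qed.

Lemma glue_eq_trans : transitive glue_eq.
Proof.
move=> v u w /asboolP uv /asboolP vw; apply/asboolP.
exact: rst_trans uv vw.
Qed.

Canonical glue_equiv : equiv_rel prerealization :=
  EquivRel glue_eq glue_eq_refl glue_eq_sym glue_eq_trans.

Definition realization : topologicalType :=
  quotient_topology {eq_quot glue_equiv}.

Definition point_of (u : prerealization) : realization :=
  \pi_(quotient_topology {eq_quot glue_equiv}) u.

Definition char_map k (x : X k) (t : stdsimplex R k) : realization :=
  point_of (pre_point x t).

Definition closed_face k (x : X k) : set realization := range (char_map x).

Lemma point_of_eq u v : point_of u = point_of v <-> glue_eq u v.
Proof. by split=> [/eqmodP//|uv]; apply/eqmodP. Qed.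

Lemma char_map_glue m n (f : 'Delta(m, n)) (x : X n) t :
  char_map (sset_map f x) t = char_map x (stdsimplex_map f t).
Proof. by apply/point_of_eq/asboolP/rst_step. Qed.

Lemma realization_continuous (Z : topologicalType) (f : realization -> Z) :
  continuous f <-> forall k (x : X k), continuous (f \o char_map x).
Proof.
split=> [cf k x|cf].
  have cp : continuous (pre_point x).
    exact: (@existT_continuous _
      (fun s : {k & X k} => stdsimplex R (tag s)) (existT _ k x)).
  have cq : continuous (f \o point_of) by apply/quotient_continuous.
  by move=> t; apply: (@continuous_comp _ _ _ (pre_point x) (f \o point_of));
    [exact: cp | exact: cq].
apply/quotient_continuous => -[[k x] t] U /(cf k x t) fU.
exact: fU.
Qed.

End Realization.

Arguments closed_face R {X k} x.

(* A left action by automorphisms of the simplicial set. *)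
Record simplicial_action (gT : finGroupType) (X : sset) := SimplicialAction {
  sact : gT -> forall k, X k -> X k;
  sact1 : forall k (x : X k), sact 1%g x = x;
  sactM : forall g h k (x : X k), sact (g * h)%g x = sact g (sact h x);
  sact_map : forall g m n (f : 'Delta(m, n)) (x : X n),
    sact g (sset_map f x) = sset_map f (sact g x) }.

Section RealizationAction.
Variables (R : realType) (gT : finGroupType) (X : sset).
Variable a : simplicial_action gT X.

Definition pre_act (g : gT) (u : prerealization R X) : prerealization R X :=
  pre_point (sact a g (tagged (tag u))) (tagged u).

Definition realization_act (g : gT) (p : realization R X) : realization R X :=
  point_of (pre_act g (repr p)).

Lemma glue_eq_pre_act g u v : glue_eq u v -> glue_eq (pre_act g u) (pre_act g v).
Proof.
move=> /asboolP uv; apply/asboolP; elim: uv => {u v}.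
- move=> _ _ [m n f x t]; apply: rst_step.
  by rewrite /pre_act /= sact_map; exact: Glue.
- by move=> u; exact: rst_refl.
- by move=> u v _; exact: rst_sym.
- by move=> u v w _ uv _ vw; exact: rst_trans uv vw.
Qed.

Lemma realization_act_point g u :
  realization_act g (point_of u) = point_of (pre_act g u).
Proof.
apply/point_of_eq/glue_eq_pre_act/point_of_eq.
by rewrite /point_of reprK.
Qed.

Lemma realization_act_char g k (x : X k) t :
  realization_act g (char_map x t) = char_map (sact a g x) t.
Proof. exact: realization_act_point. Qed.

Lemma realization_act_closed_face g k (x : X k) :
  realization_act g @` closed_face R x = closed_face R (sact a g x).
Proof.
apply/seteqP; split=> [_ [_ [t _ <-] <-]|_ [t _ <-]].
  by exists t => //; rewrite realization_act_char.
by exists (char_map x t); [exists t | rewrite realization_act_char].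
Qed.

Lemma realization_act1 p : realization_act 1%g p = p.
Proof.
rewrite -[p in RHS]reprK; congr point_of.
by case: (repr p) => -[k x] t; rewrite /pre_act /= sact1.
Qed.

Lemma realization_actM g h p :
  realization_act (g * h)%g p = realization_act g (realization_act h p).
Proof.
have -> : realization_act h p = point_of (pre_act h (repr p)) by [].
by rewrite realization_act_point /realization_act /pre_act /= sactM.
Qed.

Definition simplex_orbit k (x : X k) : set (X k) := range (fun g => sact a g x).

Definition face_orbits k : set (set (X k)) := @simplex_orbit k @` faces X k.

End RealizationAction.

Arguments simplex_orbit {gT X} a {k} x.
Arguments face_orbits {gT X} a k.

(* mx_representation is multiplicative, so g acts on column vectors from the
   left by v |-> rV g *m v. *)
Definition equivariant (R : realType) (gT : finGroupType) (n : nat) (X : sset)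
    (a : simplicial_action gT X) (rV : mx_representation R [set: gT]%G n)
    (f : realization R X -> 'cV[R]_n) : Prop :=
  forall g p, f (realization_act a g p) = rV g *m f p.

(* Main.v *)
From HB Require Import structures.
Require Import Defs.
From mathcomp Require Import all_boot all_order all_algebra all_fingroup.
From mathcomp Require Import mxrepresentation zify.
From mathcomp Require Import all_classical all_reals all_analysis.
From mathcomp Require Import generic_quotient.
Import Order.TTheory GRing.Theory Num.Theory.
Import numFieldNormedType.Exports.
Local Open Scope classical_set_scope.
Local Open Scope card_scope.
Local Open Scope ring_scope.
Set Implicit Arguments.
Unset Strict Implicit.
Unset Printing Implicit Defensive.

(* Suppose that there are fewer than 2^n orbits of n-faces, and let Y be the
   subcomplex generated by the n-faces; it has finitely many orbits of vertices.
   Give each of these orbits a vector of V, in general position even after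
   translation by G, and map Y affinely on simplices.  By freeness, the vertices
   of an n-face that lie in the same orbit are equal.  If the n+1 vertices of an
   n-face are distinct, the corresponding vectors satisfy a single linear
   relation up to scaling, with no vanishing coefficient, so exactly two of the
   2^(n+1) choices of signs for these vectors put 0 in the image of the face.
   A union bound over the orbits then gives signs for which 0 is avoided by all
   n-faces.
   There may be infinitely many other faces, of arbitrary cardinality, so their
   vertices cannot be in general position.  Those faces are instead coned off
   from an interior point whose image depends, up to translation, only on the
   dimension: only finitely many vectors are used, and at most n of them on a
   face of dimension less than n. *)

(** * Nondegenerate simplices *)

Section MkDelta.
Variables (m n : nat) (f : 'I_m.+1 -> 'I_n.+1).
Hypothesis fH : forall i j : 'I_m.+1, (i <= j)%N -> (f i <= f j)%N.

Definition mkDelta : 'Delta(m, n) :=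
  HB.pack f (Order.isOrderMorphism.Build _ _ _ _ f fH).
End MkDelta.

Lemma Delta_le m n (f : 'Delta(m, n)) (i j : 'I_m.+1) :
  (i <= j)%N -> (f i <= f j)%N.
Proof. exact: (omorph_le f). Qed.

Section Faces.
Variable X : sset.

Lemma sset_map_ext m n (f g : 'Delta(m, n)) (x : X n) :
  f =1 g -> sset_map f x = sset_map g x.
Proof.
move=> fg; pose i := @mkDelta m m id (fun _ _ => id).
by rewrite (@sset_map_comp X m m n i g f) // sset_map_id.
Qed.

Definition Dcomp l m n (g : 'Delta(m, n)) (f : 'Delta(l, m)) : 'Delta(l, n) :=
  @mkDelta l n (fun i => g (f i)) (fun i j ij => Delta_le g (Delta_le f ij)).

Lemma sset_mapM l m n (g : 'Delta(m, n)) (f : 'Delta(l, m)) (x : X n) :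
  sset_map f (sset_map g x) = sset_map (Dcomp g f) x.
Proof. by symmetry; apply: sset_map_comp. Qed.

Definition Did n : 'Delta(n, n) := @mkDelta n n id (fun _ _ => id).

Lemma sset_map1 n (x : X n) : sset_map (Did n) x = x.
Proof. exact: sset_map_id. Qed.

Lemma coface_le n (i : 'I_n.+2) (j k : 'I_n.+1) :
  (j <= k)%N -> (lift i j <= lift i k)%N.
Proof. by rewrite /= leq_bump2. Qed.
Definition coface n (i : 'I_n.+2) : 'Delta(n, n.+1) := mkDelta (@coface_le n i).

Lemma codegen_lt n (i : nat) (j : 'I_n.+2) : (i < n.+1)%N -> (unbump i j < n.+1)%N.
Proof. by have := ltn_ord j; rewrite /unbump; lia. Qed.

(* The surjection hitting [i] twice. *)
Definition codegen_fun n (i : 'I_n.+1) (j : 'I_n.+2) : 'I_n.+1 :=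
  Ordinal (codegen_lt j (ltn_ord i)).
Lemma codegen_le n (i : 'I_n.+1) (j k : 'I_n.+2) :
  (j <= k)%N -> (codegen_fun i j <= codegen_fun i k)%N.
Proof. by rewrite /= /unbump; lia. Qed.
Definition codegen n (i : 'I_n.+1) : 'Delta(n.+1, n) := mkDelta (@codegen_le n i).

Lemma codegen_surj n (i : 'I_n.+1) j : exists k, codegen i k = j.
Proof.
exists (lift (widen_ord (leqnSn _) i) j); apply/val_inj.
by rewrite /= bumpK.
Qed.

(** By monotonicity, a map that is not injective takes the same value at two consecutive elements,
    and so factors through a codegeneracy. *)
Lemma nondegenerate_inj m n (f : 'Delta(m, n)) (x : X n) :
  ~ degenerate (sset_map f x) -> injective f.
Proof.
move=> nd; apply: contrapT => ninj.
have [i [j [ij fij]]] : exists i j : 'I_m.+1, (i < j)%N /\ f i = f j.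
  apply: contrapT => H; apply: ninj => i j fij; apply/val_inj/eqP.
  by case: (ltngtP i j) => // lt; exfalso; apply: H; [exists i, j|exists j, i].
case: m f nd {ninj} i j ij fij => [|m] f nd i j ij fij.
  by case: i j ij {fij} => [[|i] ?] [[|j] ?].
have im : (i < m.+1)%N by have := ltn_ord j; lia.
pose k := Ordinal im; pose k' : 'I_m.+2 := lift ord0 k.
have fk : f i = f k'.
  apply/val_inj/eqP; rewrite eqn_leq {2}fij.
  by rewrite !Delta_le //= /bump /=; lia.
apply: nd; exists m, (codegen k), (sset_map (coface i) (sset_map f x)).
split=> //; first exact: codegen_surj.
rewrite !sset_mapM; apply: sset_map_ext => l /=.
have [->|li] := eqVneq l i.
  by rewrite fk; congr (f _); apply/val_inj; rewrite /= unbumpKcond /bump /unbump /=; lia.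
congr (f _); apply/val_inj; rewrite /= unbumpKcond.
by move/eqP : li => li; have : (l : nat) <> i by [move=> /val_inj]; lia.
Qed.

Lemma Delta_inj_ge m n (f : 'Delta(m, n)) : injective f ->
  forall i j : 'I_m.+1, (i <= j)%N -> (f i + (j - i) <= f j)%N.
Proof.
move=> fI i [j jm]; elim: j jm => [|j IH] jm /=.
  move=> i0; have -> : i = Ordinal jm by apply/val_inj => /=; lia.
  by rewrite /= subnn addn0.
rewrite leq_eqVlt => /orP[/eqP ij|].
  have -> : i = Ordinal jm by apply/val_inj.
  by rewrite /= subnn addn0.
rewrite ltnS => ij; have jm' : (j < m.+1)%N by exact: ltnW.
have := IH jm' ij.
have /(Delta_le f) : (Ordinal jm' <= Ordinal jm)%N by rewrite /=.
rewrite leq_eqVlt => /orP[/eqP/val_inj/fI []/= |/=]; lia.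
Qed.

Lemma Delta_inj_dim m n (f : 'Delta(m, n)) : injective f -> (m <= n)%N.
Proof.
move=> /Delta_inj_ge/(_ ord0 ord_max (leq0n _)) /=.
by have := ltn_ord (f ord_max); lia.
Qed.

Lemma Delta_inj_id n (f : 'Delta(n, n)) : injective f -> f =1 id.
Proof.
move=> /Delta_inj_ge fI i; apply/val_inj/eqP => /=.
have := fI ord0 i (leq0n _); have := fI i ord_max (leq_ord i).
have := ltn_ord (f ord_max); have := ltn_ord i => /=; lia.
Qed.

Definition Dsurj m n (f : 'Delta(m, n)) := forall j, exists i, f i = j.

(** Every section of a monotone surjection is monotone, so one of its values can be prescribed. *)
Lemma Dsurj_section k m (s : 'Delta(k, m)) (i0 : 'I_k.+1) : Dsurj s ->
  exists d : 'Delta(m, k), (forall j, s (d j) = j) /\ d (s i0) = i0.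
Proof.
move=> /choice[e eK]; pose d j := if j == s i0 then i0 else e j.
have dK j : s (d j) = j by rewrite /d; case: eqP => // ->.
have dH (i j : 'I_m.+1) : (i <= j)%N -> (d i <= d j)%N.
  rewrite leq_eqVlt => /orP[/eqP/val_inj->//|].
  rewrite -{1}(dK i) -{1}(dK j) !ltnNge => H.
  by rewrite leqNgt; apply: contra H => /ltnW/Delta_le.
by exists (mkDelta dH); split => //=; rewrite /d eqxx.
Qed.

(** Uniqueness in the Eilenberg-Zilber lemma. Sections exhibit each of [y] and [z] as a face of the
    other along injections, so the dimensions agree and the injections are identities; sections
    through every point then give [s =1 t]. The predicate [Q] replaces an equality of dependent
    triples. *)
Lemma nondegenerate_uniq k m n (s : 'Delta(k, m)) (t : 'Delta(k, n))
    (y : X m) (z : X n) (Q : forall p, X p -> ('I_k.+1 -> 'I_p.+1) -> Prop) :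
    Dsurj s -> Dsurj t -> ~ degenerate y -> ~ degenerate z ->
    sset_map s y = sset_map t z ->
  Q m y s -> Q n z t.
Proof.
move=> sS tS yN zN e.
have key k' m' n' (s' : 'Delta(k', m')) (t' : 'Delta(k', n'))
    (y' : X m') (z' : X n') (d : 'Delta(m', k')) :
    ~ degenerate y' -> sset_map s' y' = sset_map t' z' -> (forall j, s' (d j) = j) ->
    y' = sset_map (Dcomp t' d) z' /\ injective (Dcomp t' d).
  move=> yN' e' dK; have ye : y' = sset_map (Dcomp t' d) z'.
    by rewrite -sset_mapM -e' sset_mapM sset_map_id.
  by split=> //; apply: (@nondegenerate_inj _ _ _ z'); rewrite -ye.
have mn : m = n.
  have [d [dK _]] := Dsurj_section ord0 sS; have [d' [d'K _]] := Dsurj_section ord0 tS.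
  have [_ /Delta_inj_dim] := key _ _ _ s t y z d yN e dK.
  have [_ /Delta_inj_dim] := key _ _ _ t s z y d' zN (esym e) d'K.
  lia.
subst n.
have st : s =1 t.
  move=> i; have [d [dK di]] := Dsurj_section i sS.
  have [_ /Delta_inj_id/(_ (s i)) /=] := key _ _ _ s t y z d yN e dK.
  by rewrite di.
have <- : y = z.
  have [d [dK _]] := Dsurj_section ord0 sS.
  have [-> /Delta_inj_id I] := key _ _ _ s t y z d yN e dK.
  by rewrite sset_map_id.
by have -> : (t : _ -> _) = s by apply/funext => i; rewrite st.
Qed.

Lemma ez_exists k (x : X k) : exists m (s : 'Delta(k, m)) (y : X m),
  [/\ (m <= k)%N, Dsurj s, ~ degenerate y & x = sset_map s y].
Proof.
elim/ltn_ind: k x => k IH x; have [[m [f [y [mk fS ->]]]]|nd] := pselect (degenerate x).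
  have [p [s [z [pm sS zN ->]]]] := IH m mk y.
  exists p, (Dcomp s f), z; split=> //; [lia| |by rewrite sset_mapM].
  by move=> j; have [i <-] := sS j; have [l <-] := fS i; exists l.
exists k, (Did k), x; split=> //; last by rewrite sset_map1.
by move=> j; exists j.
Qed.

End Faces.

(** * Maps defined by successive coning *)

Section Push.
Variable R : realType.

(** Coordinates are plain functions with no constraint on their sum, because the recursion below
    subtracts their minimum. *)
Definition push m n (f : 'I_m.+1 -> 'I_n.+1) (u : 'I_m.+1 -> R) : 'I_n.+1 -> R :=
  fun j => \sum_(i | f i == j) u i.

Lemma push_id m (f : 'I_m.+1 -> 'I_m.+1) u : f =1 id -> push f u = u.
Proof.
move=> fid; apply/funext => j; rewrite /push (bigD1 j) ?fid //= big1 ?addr0 //.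
by move=> i; rewrite fid => /andP[/eqP-> /eqP].
Qed.

Lemma push_comp l m n (f : 'I_l.+1 -> 'I_m.+1) (g : 'I_m.+1 -> 'I_n.+1) u :
  push g (push f u) = push (g \o f) u.
Proof.
apply/funext => j; rewrite /push [RHS](partition_big f (fun i => g i == j)) //=.
apply: eq_bigr => i /eqP gi; apply: eq_bigl => k.
by case: (f k =P i) => [->|]; rewrite ?andbF // gi eqxx.
Qed.

Lemma push_ge0 m n (f : 'I_m.+1 -> 'I_n.+1) u :
  (forall i, 0 <= u i) -> forall j, 0 <= push f u j.
Proof. by move=> u0 j; apply: sumr_ge0. Qed.

Lemma push_lin m n (f : 'I_m.+1 -> 'I_n.+1) (V : lmodType R) u (a : 'I_n.+1 -> V) :
  \sum_j push f u j *: a j = \sum_i u i *: a (f i).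
Proof.
rewrite [RHS](partition_big f xpredT) //=; apply: eq_bigr => j _.
by rewrite /push scaler_suml; apply: eq_bigr => i /eqP ->.
Qed.

Lemma push_eq0 m n (f : 'I_m.+1 -> 'I_n.+1) u : (forall i, 0 <= u i) ->
  (forall j, push f u j = 0) -> forall i, u i = 0.
Proof.
move=> u0 p0 i; have /psumr_eq0P := p0 (f i).
by apply=> [//|]; rewrite eqxx.
Qed.

Lemma push_lift m (i : 'I_m.+2) (u : 'I_m.+1 -> R) j : push (lift i) u (lift i j) = u j.
Proof.
rewrite /push (bigD1 j) //= big1 ?addr0 //.
by move=> k /andP[/eqP/lift_inj->]; rewrite eqxx.
Qed.

Lemma push_lift0 m (i : 'I_m.+2) (u : 'I_m.+1 -> R) : push (lift i) u i = 0.
Proof. by rewrite /push big1 // => k /eqP e; have := neq_lift i k; rewrite e eqxx. Qed.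

Lemma push_liftK m (i : 'I_m.+2) (u : 'I_m.+2 -> R) :
  u i = 0 -> push (lift i) (fun j => u (lift i j)) = u.
Proof.
move=> ui; apply/funext => j; case: (unliftP i j) => [k ->|->]; last by rewrite push_lift0.
by rewrite push_lift.
Qed.

End Push.

Section Cone.
Variables (R : realType) (X : sset) (V : lmodType R) (F : forall k, X k -> V).

Definition argmin m (u : 'I_m.+1 -> R) : 'I_m.+1 := [arg min_(i < ord0) u i]%O.

Lemma argminP m (u : 'I_m.+1 -> R) j : u (argmin u) <= u j.
Proof. by rewrite /argmin; case: arg_minP => //= i _ /(_ j isT). Qed.

Record ez_data k (x : X k) := EZ {
  ezd : nat; ezs : 'Delta(k, ezd); ezy : X ezd;
  ez_le : (ezd <= k)%N; ez_surj : Dsurj ezs; ez_nd : ~ degenerate ezy;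
  ez_eq : x = sset_map ezs ezy }.

Lemma ez_ex k (x : X k) : inhabited (ez_data x).
Proof. by have [m [s [y [*]]]] := ez_exists x; constructor; exists m s y. Qed.

Definition ez k (x : X k) : ez_data x :=
  projT1 (cid (let: inhabits e := ez_ex x in ex_intro (fun _ => True) e I)).

(** Subtracting the least coordinate from all of them leaves a point of the opposite facet. So [F y]
    is the image of the sum of the vertices, [m.+1] times the barycenter, and the map is the
    homogeneous form of the cone from the barycenter over the boundary. *)
Definition cone_step (rec : forall k, X k -> ('I_k.+1 -> R) -> V) m :
    X m -> ('I_m.+1 -> R) -> V :=
  match m with
  | 0 => fun y u => u ord0 *: F y
  | m'.+1 => fun y u => let i := argmin u in
      u i *: F y + rec m' (sset_map (coface i) y) (fun j => u (lift i j) - u i)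
  end.

(** [N] is fuel; the value 0 is not reached when [k < N], as each step lowers the dimension. *)
Fixpoint cone_rec N k (x : X k) (u : 'I_k.+1 -> R) : V :=
  if N is N'.+1 then cone_step (cone_rec N') (ezy (ez x)) (push (ezs (ez x)) u)
  else 0.

Definition cone_map k (x : X k) u := cone_rec k.+1 x u.

Lemma cone_rec_stable N k (x : X k) u : (k < N)%N -> cone_rec N x u = cone_map x u.
Proof.
rewrite /cone_map; have [M] := ubnP k; elim: M N k x u => // M IH [//|N] k x u kM kN.
rewrite /=; case: (ez x) => [[|m] s y mk] sS yN e //=.
by congr (_ + _); rewrite [LHS]IH 1?[RHS]IH //; lia.
Qed.

Lemma cone_mapE k (x : X k) u :
  cone_map x u = cone_step cone_map (ezy (ez x)) (push (ezs (ez x)) u).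
Proof.
rewrite {1}/cone_map /=; case: (ez x) => [[|m] s y mk] sS yN e //=.
by rewrite cone_rec_stable.
Qed.

Lemma cone_map_step k m (s : 'Delta(k, m)) (y : X m) u : Dsurj s -> ~ degenerate y ->
  cone_map (sset_map s y) u = cone_step cone_map y (push s u).
Proof.
move=> sS yN; rewrite cone_mapE.
have := @nondegenerate_uniq X k _ _ (ezs (ez (sset_map s y))) s _ y
  (fun p z f => cone_step cone_map (ezy (ez (sset_map s y))) (push (ezs (ez (sset_map s y))) u)
    = cone_step cone_map z (push f u)).
apply=> //; first exact: ez_surj; first exact: ez_nd.
by rewrite -ez_eq.
Qed.

Lemma Did_surj n : Dsurj (Did n). Proof. by move=> j; exists j. Qed.

Lemma cone_map_nd m (y : X m) u : ~ degenerate y ->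
  cone_map y u = cone_step cone_map y u.
Proof.
move=> yN; rewrite -{1}(sset_map1 y) cone_map_step //; last exact: Did_surj.
by rewrite push_id.
Qed.

Lemma cone_map_surj k m (s : 'Delta(k, m)) (y : X m) u : Dsurj s -> ~ degenerate y ->
  cone_map (sset_map s y) u = cone_map y (push s u).
Proof. by move=> sS yN; rewrite cone_map_step // cone_map_nd. Qed.

Lemma cone_map0 k (x : X k) : cone_map x (fun=> 0) = 0.
Proof.
elim/ltn_ind: k x => k IH x.
have [m [s [y [mk sS yN ->]]]] := ez_exists x; rewrite cone_map_step //.
have -> : push s (fun=> 0) = (fun=> 0) :> (_ -> R) by apply/funext => j; rewrite /push big1.
case: m s y mk sS yN => [|m] s y mk sS yN /=; first by rewrite scale0r.
rewrite scale0r add0r -[RHS](IH m mk (sset_map (coface (argmin (fun=> 0))) y)).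
by congr cone_map; apply/funext => j; rewrite subr0.
Qed.

(* Naturality is first needed, one dimension lower, to see that the recursion
   does not depend on which minimal coordinate is removed. *)
Let nat_at m := forall l (f : 'Delta(l, m)) (x : X m) u, (forall i, 0 <= u i) ->
  cone_map (sset_map f x) u = cone_map x (push f u).

(** By naturality in dimension [m], both sides are values on the common face of codimension 2 that
    omits [i] and [i']. *)
Lemma cone_map_choice m (y : X m.+1) (v : 'I_m.+2 -> R) i i' : nat_at m ->
    (forall j, 0 <= v j) -> v i = 0 -> v i' = 0 ->
  cone_map (sset_map (coface i) y) (fun j => v (lift i j)) =
  cone_map (sset_map (coface i') y) (fun j => v (lift i' j)).
Proof.
move=> natm v0 vi vi'; have [->//|ii'] := eqVneq i i'.
have [j' ei' _] := unlift_some ii'.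
case: m y v i i' natm v0 vi vi' ii' j' ei' => [|m] y v i i' natm v0 vi vi' ii' j' ei'.
  (* An edge has no face of codimension 2, but both its coordinates vanish. *)
  have v00 j : v j = 0.
    have [->//|ji] := eqVneq j i; suff -> : j = i' by [].
    move: i i' j ii' ji {vi vi' ei'}.
    by case=> [[|[|?]] ?] [[|[|?]] ?] [[|[|?]] ?] // _ _; apply/val_inj.
  have e k : (fun j => v (lift k j)) = (fun=> 0) by apply/funext => j; rewrite v00.
  by rewrite !e !cone_map0.
have [j ei _] : {j | i = lift i' j & unlift i' i = Some j}.
  by apply: unlift_some; rewrite eq_sym.
have vj' : v (lift i j') = 0 by rewrite -ei'.
have vj : v (lift i' j) = 0 by rewrite -ei.
rewrite -(@push_liftK R m j' (fun j => v (lift i j))) //.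
rewrite -(@push_liftK R m j (fun j => v (lift i' j))) //.
rewrite -!(natm _ (coface _)) // !sset_mapM.
have ll l : lift i (lift j' l) = lift i' (lift j l).
  apply/val_inj; have := congr1 val ei'; have := congr1 val ei.
  by rewrite /= /bump; lia.
congr cone_map; last by apply/funext => l; rewrite ll.
by apply: sset_map_ext => l /=; exact: ll.
Qed.

Let cone_map_min_at m (y : X m.+1) (u : 'I_m.+2 -> R) i : nat_at m ->
    ~ degenerate y -> (forall j, u i <= u j) ->
  cone_map y u = u i *: F y +
    cone_map (sset_map (coface i) y) (fun j => u (lift i j) - u i).
Proof.
move=> natm yN ui; rewrite cone_map_nd //=; set a := argmin u.
have uai : u a = u i by apply/eqP; rewrite eq_le ui argminP.
rewrite uai; congr (_ + _).
apply: (@cone_map_choice m y (fun j => u j - u i)) => //= [j| |].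
- by rewrite subr_ge0.
- by rewrite uai subrr.
- by rewrite subrr.
Qed.

(** After reduction to a nondegenerate [y], a surjective [f] is settled by uniqueness of the
    Eilenberg-Zilber decomposition. Otherwise [f] misses some [i] and factors through [coface i];
    the pushed coordinates have minimum 0 at [i], so the apex disappears and naturality on the facet
    applies. *)
Lemma cone_map_nat l m (f : 'Delta(l, m)) (x : X m) u : (forall i, 0 <= u i) ->
  cone_map (sset_map f x) u = cone_map x (push f u).
Proof.
elim/ltn_ind: m l f x u => m IH.
suff nd m' l (f : 'Delta(l, m')) (y : X m') u : (m' <= m)%N -> ~ degenerate y ->
    (forall i, 0 <= u i) -> cone_map (sset_map f y) u = cone_map y (push f u).
  move=> l f x u u0; have [m' [s [y [mm' sS yN ->]]]] := ez_exists x.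
  rewrite sset_mapM nd // cone_map_surj // push_comp.
  by congr cone_map.
move=> mm' yN u0; have [fS|nS] := pselect (Dsurj f); first exact: cone_map_surj.
have {nS}[i fi] : exists i, forall j, i != f j.
  apply: contrapT => H; apply: nS => i; apply: contrapT => H'; apply: H; exists i => j.
  by apply/eqP => e; apply: H'; exists j.
case: m' f y mm' yN i fi => [|m'] f y mm' yN i fi.
  by have := fi ord0; rewrite !ord1 eqxx.
pose g j : 'I_m'.+1 := odflt ord0 (unlift i (f j)).
have gE j : lift i (g j) = f j by rewrite /g; case: (unlift_some (fi j)) => k /= e ->; rewrite e.
have gH (j k : 'I_l.+1) : (j <= k)%N -> (g j <= g k)%N.
  by move=> /(Delta_le f); rewrite -!gE /= leq_bump2.
have -> : sset_map f y = sset_map (mkDelta gH) (sset_map (coface i) y).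
  by rewrite sset_mapM; apply: sset_map_ext => j /=; rewrite gE.
have natm' : nat_at m' by apply: IH.
rewrite natm' //; set v := push _ u.
have v0 j : 0 <= v j by apply: push_ge0.
have -> : push f u = push (lift i) v.
  by rewrite push_comp; congr push; apply/funext => j /=; rewrite gE.
rewrite (@cone_map_min_at _ _ _ i) // push_lift0; last by move=> j; apply: push_ge0.
rewrite scale0r add0r; congr cone_map.
by apply/funext => j; rewrite push_lift subr0.
Qed.

Lemma cone_map_min m (y : X m.+1) (u : 'I_m.+2 -> R) i :
    ~ degenerate y -> (forall j, u i <= u j) ->
  cone_map y u = u i *: F y +
    cone_map (sset_map (coface i) y) (fun j => u (lift i j) - u i).
Proof. by apply: cone_map_min_at => l f x v; exact: cone_map_nat. Qed.

Lemma cone_map_vertex (y : X 0) (u : 'I_1 -> R) : cone_map y u = u ord0 *: F y.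
Proof. by rewrite cone_map_nd // => -[m [f [z []]]]. Qed.

End Cone.

(** * Equivariant and affine coned maps *)

Section ConeMorphism.
Variables (R : realType) (X : sset) (V W : lmodType R).
Variables (F : forall k, X k -> V) (H : forall k, X k -> W).
Variables (h : forall k, X k -> X k) (L : {linear V -> W}).
Hypothesis h_map : forall m n (f : 'Delta(m, n)) (x : X n),
  h (sset_map f x) = sset_map f (h x).
Hypothesis h_nd : forall k (x : X k), ~ degenerate x -> ~ degenerate (h x).
Hypothesis FH : forall k (x : X k), L (F x) = H (h x).

Lemma cone_map_morph k (x : X k) u : L (cone_map F x u) = cone_map H (h x) u.
Proof.
elim/ltn_ind: k x u => k IH x u.
have [m [s [y [mk sS yN ->]]]] := ez_exists x.
rewrite h_map !cone_map_surj //; last exact: h_nd.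
rewrite !cone_map_nd //; last exact: h_nd.
move: (push s u) => {s sS}; case: m y mk yN => [|m] y mk yN v /=.
  by rewrite linearZ /= FH.
by rewrite linearD linearZ /= FH IH // h_map.
Qed.

End ConeMorphism.

Section ConeAffine.
Variables (R : realType) (X : sset) (V : lmodType R) (F : forall k, X k -> V).
Variables (P : forall k, X k -> Prop) (c : X 0 -> V).

Definition vertex k (x : X k) (i : 'I_k.+1) : X 0 :=
  sset_map (@mkDelta 0 k (fun=> i) (fun _ _ _ => leqnn i)) x.

Lemma vertex_map m n (f : 'Delta(m, n)) (x : X n) i :
  vertex (sset_map f x) i = vertex x (f i).
Proof. by rewrite /vertex sset_mapM; apply: sset_map_ext. Qed.

Lemma vertex0 (x : X 0) i : vertex x i = x.
Proof. by apply: sset_map_id => j /=; rewrite !ord1. Qed.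

Hypothesis P_map : forall m n (f : 'Delta(m, n)) (x : X n), P x -> P (sset_map f x).
Hypothesis FP : forall k (x : X k), P x -> F x = \sum_i c (vertex x i).

(** When the apex is the sum of the vertex values, its term gives back to every vertex the minimum
    that was subtracted from its coordinate. *)
Lemma cone_map_affine k (x : X k) u : P x ->
  cone_map F x u = \sum_i u i *: c (vertex x i).
Proof.
elim/ltn_ind: k x u => k IH x u.
have [m [s [y [mk sS yN ->]]]] := ez_exists x => Px.
have Py : P y.
  have [d [dK _]] := Dsurj_section ord0 sS.
  by have := P_map d Px; rewrite sset_mapM sset_map_id.
rewrite cone_map_surj // cone_map_nd //.
under eq_bigr do rewrite vertex_map.
rewrite -(@push_lin _ _ _ s _ u (fun j => c (vertex y j))).
move: (push s u) => {s sS Px}; case: m y mk yN Py => [|m] y mk yN Py v /=.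
  by rewrite FP // !big_ord1.
set a := argmin v; rewrite IH //; last exact: P_map.
rewrite FP // (bigD1_ord a) //= [RHS](bigD1_ord a) //= scalerDr -addrA; congr (_ + _).
rewrite scaler_sumr -big_split /=; apply: eq_bigr => j _.
by rewrite vertex_map /= -scalerDl addrC subrK.
Qed.

End ConeAffine.

(** * Continuity and the induced map on the realization *)

Section Continuity.
Variable R : realType.

Lemma finite_closed_pasting (T : topologicalType) (V : normedModType R) (I : finType)
    (C : I -> T -> Prop) (g : I -> T -> V) (f : T -> V) :
    (forall t, exists i, C i t) -> (forall i t, C i t -> f t = g i t) ->
    (forall i t, ~ C i t -> \forall s \near t, ~ C i s) ->
    (forall i, continuous (g i)) ->
  continuous f.
Proof.
move=> cov fg Cc gc t; apply/cvgrPdist_lt => e e0.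
have : \forall s \near t, forall i, C i s -> `|f t - f s| < e.
  apply: filter_forall => i; have [Ct|nC] := pselect (C i t).
    have /cvgrPdist_lt/(_ e e0) := gc i t.
    by apply: filterS => s gs Cs; rewrite (fg i) // (fg i s).
  by apply: filterS (Cc i t nC) => s nCs Cs.
by apply: filterS => s H; have [i /H] := cov s.
Qed.

Lemma continuous_bigsum (T : topologicalType) (V : normedModType R) (I : Type)
    (r : seq I) (P : pred I) (h : I -> T -> V) :
  (forall i, P i -> continuous (h i)) -> continuous (fun t => \sum_(i <- r | P i) h i t).
Proof.
move=> hc; elim: r => [|i r IH].
  rewrite (_ : (fun _ => _) = cst 0); first exact: cst_continuous.
  by apply/funext => t; rewrite big_nil.
rewrite (_ : (fun _ => _) =
  if P i then (fun t => h i t + \sum_(j <- r | P j) h j t)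
  else (fun t => \sum_(j <- r | P j) h j t)); last first.
  by apply/funext => t; rewrite big_cons; case: ifP.
case: ifP => [Pi|//] t.
by apply: continuousD; [exact: hc|exact: IH].
Qed.

Variables (X : sset) (V : normedModType R) (F : forall k, X k -> V).

(** The coordinates form a family over an arbitrary space [T], so that the induction also covers the
    coordinates left on a facet. *)
Lemma cone_map_continuous k (x : X k) (T : topologicalType) (h : T -> 'I_k.+1 -> R) :
    (forall i, continuous (fun t => h t i)) -> (forall t i, 0 <= h t i) ->
  continuous (fun t => cone_map F x (h t)).
Proof.
elim/ltn_ind: k x T h => k IH x T h hc h0.
suff nd m (y : X m) (v : T -> 'I_m.+1 -> R) : (m <= k)%N -> ~ degenerate y ->
    (forall i, continuous (fun t => v t i)) -> (forall t i, 0 <= v t i) ->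
    continuous (fun t => cone_map F y (v t)).
  have [m [s [y [mk sS yN ->]]]] := ez_exists x.
  have -> : (fun t => cone_map F (sset_map s y) (h t)) =
      (fun t => cone_map F y (push s (h t))).
    by apply/funext => t; rewrite cone_map_surj.
  apply: nd => // [i|t i]; last exact: push_ge0.
  by apply: (@continuous_bigsum T R^o) => j _; exact: hc.
case: m y v => [|m] y v mk yN vc v0.
  have -> : (fun t => cone_map F y (v t)) = (fun t => v t ord0 *: F y).
    by apply/funext => t; rewrite cone_map_vertex.
  by move=> t; apply: continuousZr_tmp; exact: vc.
pose C i t := forall j, v t i <= v t j.
(* Outside [C i] the differences may be negative; truncating them at 0 keeps the family nonnegative,
   as the induction requires. *)
pose g i t := v t i *: F y + cone_map F (sset_map (coface i) y)
  (fun j => Num.max (v t (lift i j) - v t i) 0).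
apply: (@finite_closed_pasting _ _ _ C g).
- by move=> t; exists (argmin (v t)) => j; exact: argminP.
- move=> i t Ct; rewrite (@cone_map_min _ _ _ F _ _ _ i) //; congr (_ + _).
  congr cone_map; apply/funext => j; apply/esym/max_idPl.
  by rewrite subr_ge0.
- move=> i t /existsNP[j /negP]; rewrite -ltNge => vji.
  have : v t i - v t j > 0 by rewrite subr_gt0.
  have /cvgr_gt H : (fun s => v s i - v s j) @ t --> v t i - v t j.
    by apply: cvgB; exact: vc.
  by move=> /H; apply: filterS => r; rewrite subr_gt0 ltNge => /negP nC /(_ j).
- move=> i t; rewrite /g; apply: cvgD; first by apply: continuousZr_tmp; exact: vc.
  apply: (IH m) => //= [j r|r j]; last by rewrite le_max lexx orbT.
  apply: (@continuous_max R T (fun t => v t (lift i j) - v t i) (fun=> 0)).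
    by apply: continuousB; exact: vc.
  exact: cst_continuous.
Qed.

Lemma simplex_coord_continuous k i : continuous (fun t : stdsimplex R k => val t 0 i : R).
Proof.
move=> t; apply: (@continuous_comp _ _ _ (fun t : stdsimplex R k => val t) (fun M => M 0 i)).
  exact: initial_continuous.
exact: coord_continuous.
Qed.

(** The choice of representative is harmless by [realization_map_char], which rests on naturality of
    [cone_map]. *)
Definition realization_map (p : realization R X) : V :=
  let u := repr p in cone_map F (tagged (tag u)) (fun i => val (tagged u) 0 i).

Lemma stdsimplex_ge0 k (t : stdsimplex R k) i : 0 <= val t 0 i.
Proof. by have [] := set_valP t. Qed.

Lemma realization_map_char k (x : X k) t :
  realization_map (char_map x t) = cone_map F x (fun i => val t 0 i).
Proof.
pose f (u : prerealization R X) := cone_map F (tagged (tag u)) (fun i => val (tagged u) 0 i).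
suff fE u v : glue_eq u v -> f u = f v.
  apply: (fE _ (pre_point x t)).
  by apply/point_of_eq; rewrite /point_of reprK.
move=> /asboolP; elim=> {u v} //; last by move=> u v w _ -> _ ->.
move=> _ _ [m n g y r]; rewrite /f /= cone_map_nat; last by move=> i; exact: stdsimplex_ge0.
by congr cone_map; apply/funext => j; rewrite /= mxE.
Qed.

Lemma realization_map_continuous : continuous realization_map.
Proof.
apply/realization_continuous => k x.
have -> : realization_map \o char_map x = fun t => cone_map F x (fun i => val t 0 i).
  by apply/funext => t /=; exact: realization_map_char.
apply: cone_map_continuous => [i|t i]; [exact: simplex_coord_continuous|exact: stdsimplex_ge0].
Qed.

End Continuity.

(** * General position and signs *)

(** The vector is taken on the moment curve, along which each linear form is a nonzero polynomial;
    the product of these has finitely many roots. *)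
Lemma avoid_hyperplanes (R : realType) n (s : seq 'rV[R]_n) :
  (forall l, l \in s -> l != 0) ->
  exists w : 'cV[R]_n, forall l, l \in s -> l *m w != 0.
Proof.
move=> s0; pose q := \prod_(l <- s) rVpoly l.
have q0 : q != 0.
  rewrite /q big_seq; elim/big_ind: _ => [|p r p0 r0|l /s0]; first exact: oner_neq0.
    by rewrite mulf_neq0.
  by apply: contra => /eqP l0; rewrite -(rVpolyK l) l0 linear0.
have [x qx] : exists x : R, ~~ root q x.
  apply: contrapT => H.
  have := @max_poly_roots _ q [seq i%:R | i <- iota 0 (size q)] q0.
  rewrite size_map size_iota ltnn => A; suff: false by []; apply: A.
    by apply/allP => x _; apply: contrapT => rx; apply: H; exists x; exact/negP.
  by rewrite map_inj_uniq ?iota_uniq // => i j /eqP; rewrite eqr_nat => /eqP.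
exists (\col_j x ^+ j) => l ls; apply: contra qx => /eqP/matrixP/(_ 0 0) lw.
have lx : (rVpoly l).[x] = 0.
  move: lw; rewrite mxE [RHS]mxE => <-; rewrite /rVpoly horner_poly.
  by apply: eq_bigr => j _; rewrite mxE valK.
by rewrite /root /q horner_prod prodf_seq_eq0; apply/hasP; exists l => //=; rewrite lx.
Qed.

Lemma annihilator (R : realType) n (J : finType) (u : J -> 'cV[R]_n) (S : pred J) :
  (#|S| < n)%N -> exists2 l : 'rV[R]_n, l != 0 & forall j, S j -> l *m u j = 0.
Proof.
move=> Sn; pose A := \matrix_(r < n, j < #|S|) u (enum_val j) r 0.
have rA : kermx A != 0.
  rewrite -mxrank_eq0 mxrank_ker subn_eq0 -ltnNge.
  exact: leq_ltn_trans (rank_leq_col A) Sn.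
exists (nz_row (kermx A)) => [|j Sj]; first by rewrite nz_row_eq0.
have /sub_kermxP/matrixP lA : (nz_row (kermx A) <= kermx A)%MS by apply: nz_row_sub.
apply/matrixP => a b; rewrite !ord1.
move: (nz_row _) lA => l lA.
have := lA 0 (enum_rank_in (A := S) Sj j); rewrite !mxE => l0; rewrite -[RHS]l0.
by apply: eq_bigr => i _; rewrite !mxE enum_rankK_in.
Qed.

Section GeneralPosition.
Variables (R : realType) (gT : finGroupType) (n : nat).
Variable rV : mx_representation R [set: gT]%G n.

(** Linear independence of every subfamily of at most [n] vectors, after any translation of each of
    them; the subfamily is the support of [c]. *)
Definition general_position (I : finType) (w : I -> 'cV[R]_n) :=
  forall (g : I -> gT) (c : I -> R), (#|[pred i | c i != 0%R]| <= n)%N ->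
    \sum_i c i *: (rV (g i) *m w i) = 0 -> forall i, c i = 0.

(** The vectors are chosen one at a time. For all translations and every set of fewer than [n]
    earlier vectors, a hyperplane contains their translates, and the translate of the new vector has
    to avoid it. *)
Lemma general_position_ord M : exists w : 'I_M -> 'cV[R]_n, general_position w.
Proof.
elim: M => [|M [w wP]]; first by exists (fun=> 0) => g c _ _ [].
(* A triple holds the translations of the earlier vectors, the set of those in use, and the
   translation of the new one. *)
pose T : finType := ({ffun 'I_M -> gT} * {ffun 'I_M -> bool} * gT)%type.
have /choice[l lP] (p : T) : exists l : 'rV[R]_n, (#|[pred j | p.1.2 j]| < n)%N ->
    l != 0 /\ forall j, p.1.2 j -> l *m (rV (p.1.1 j) *m w j) = 0.
  have [Sn|] := ltnP #|[pred j | p.1.2 j]| n; last by exists 0.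
  by have [l l0 lS] := annihilator (fun j => rV (p.1.1 j) *m w j) Sn; exists l.
pose s := [seq l p *m rV p.2 | p : T <- enum T & (#|[pred j | p.1.2 j]| < n)%N].
have [v vP] : exists v : 'cV[R]_n, forall l, l \in s -> l *m v != 0.
  apply: avoid_hyperplanes => _ /mapP[p pT ->]; move: pT; rewrite mem_filter => /andP[pn _].
  have [lp0 _] := lP p pn; apply: contra lp0 => /eqP e.
  have pu : rV p.2 \in unitmx by apply: repr_mx_unit; rewrite inE.
  by rewrite -(mulmxK pu (l p)) e mul0mx.
exists (fun i => if unlift ord_max i is Some j then w j else v) => g c cn.
pose W j := widen_ord (leqnSn M) j.
have WE j : W j = lift ord_max j by apply/val_inj; rewrite /= /bump leqNgt ltn_ord.
rewrite big_ord_recr /= unlift_none.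
under eq_bigr => j _ do rewrite -/(W j) (WE j) liftK -(WE j).
have {cn}cn : (#|[pred j | c (W j) != 0%R]| + (c ord_max != 0%R) <= n)%N.
  apply: leq_trans cn; rewrite -!sum1_card !(big_mkcond (fun _ => _ \in _)) big_ord_recr /=.
  by rewrite leq_add //; case: (c ord_max != 0).
have [cm|cm] := eqVneq (c ord_max) 0.
  rewrite cm scale0r addr0 => /(wP (g \o W)) -/(_ _) H i.
  rewrite cm eqxx addn0 in cn; have {}H := H cn.
  by case: (unliftP ord_max i) => [j ->|->//]; rewrite -WE H.
rewrite cm addn1 in cn.
pose p : T := ([ffun j => g (W j)], [ffun j => c (W j) != 0], g ord_max).
have pn : (#|[pred j | p.1.2 j]| < n)%N.
  by apply: leq_trans cn; rewrite ltnS; apply: eq_leq; apply: eq_card => j; rewrite !inE /= ffunE.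
have [_ lS] := lP p pn.
(* The functional [l p] kills every earlier term and leaves a multiple of a value that [vP] makes
   nonzero. *)
move=> /(congr1 (mulmx (l p))); rewrite mulmxDr mulmx_sumr big1 => [|j _]; last first.
  have [->|cj] := eqVneq (c (W j)) 0; first by rewrite scale0r mulmx0.
  by have := lS j; rewrite /= !ffunE -scalemxAr => ->; rewrite ?scaler0.
rewrite add0r mulmx0 -scalemxAr => /eqP; rewrite scaler_eq0 (negPf cm) /= mulmxA => e.
have /vP : l p *m rV p.2 \in s by apply: map_f; rewrite mem_filter pn mem_enum.
by rewrite e.
Qed.

Lemma general_position_exists (I : finType) : exists w : I -> 'cV[R]_n, general_position w.
Proof.
have [w wP] := general_position_ord #|I|; exists (w \o enum_rank) => g c cn s0 i.
have := wP (g \o enum_val) (c \o enum_val) _ _ (enum_rank i); rewrite /= enum_rankK; apply.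
  apply: leq_trans cn; rewrite -(card_imset _ (@enum_val_inj _ I)).
  by apply: subset_leq_card; apply/fintype.subsetP => _ /imsetP[j jc ->].
rewrite -[RHS]s0 (reindex _ (onW_bij _ (@enum_val_bij I))) /=.
by apply: eq_bigr => j _; rewrite enum_valK.
Qed.

Lemma general_position_sign (I : finType) (w : I -> 'cV[R]_n) (e : I -> bool) :
  general_position w -> general_position (fun i => (-1) ^+ e i *: w i).
Proof.
move=> wP g c cn s0 i; have := wP g (fun i => c i * (-1) ^+ e i) _ _ i.
move=> H; apply/eqP; have /eqP : c i * (-1) ^+ e i = 0.
  apply: H; last first.
    by rewrite -[RHS]s0; apply: eq_bigr => j _; rewrite -scalemxAr scalerA.
  apply: leq_trans cn; apply: eq_leq; apply: eq_card => j; rewrite !inE.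
  by rewrite mulf_eq0 signr_eq0 orbF.
by rewrite mulf_eq0 signr_eq0 orbF.
Qed.

End GeneralPosition.

(** Each pair [(j, b)] prescribes [e] on [n.+1] distinct indices, and so excludes at most a fraction
    1 / 2^(n+1) of all [e]; as [N < 2 ^ n], the 2N pairs cannot exclude everything. *)
Lemma signs_union_bound n N (I : finType) (o : 'I_N -> 'I_n.+1 -> I)
    (s : 'I_N -> 'I_n.+1 -> bool) : (N < 2 ^ n)%N ->
  exists e : {ffun I -> bool}, forall j b, injective (o j) ->
    ~ (forall a, e (o j a) = b (+) s j a).
Proof.
move=> Nn; apply: contrapT => H.
pose B (p : 'I_N * bool) : pred {ffun I -> bool} :=
  [pred e : {ffun I -> bool} | injectiveb (o p.1) && [forall a, e (o p.1 a) == p.2 (+) s p.1 a]].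
have HB e : exists p, B p e.
  apply: contrapT => H'; apply: H; exists e => j b jI js; apply: H'.
  by exists (j, b); apply/andP; split; [exact/injectiveP|apply/forallP => a /=; rewrite js].
have cB p : (#|B p| * 2 ^ n.+1 <= 2 ^ #|I|)%N.
  have [oI|oNI] := boolP (injectiveb (o p.1)); last first.
    by rewrite eq_card0 // => e; rewrite !inE (negPf oNI).
  move/injectiveP: oI => oI.
  (* [B p] lies in a product of sets of values, with one element over the image of [o p.1] and two
     elsewhere. *)
  pose D (i : I) : pred bool :=
    if [pick a | o p.1 a == i] is Some a then pred1 (p.2 (+) s p.1 a) else predT.
  apply: (@leq_trans (#|family D| * 2 ^ n.+1)).
    rewrite leq_mul2r; apply/orP; right; apply: subset_leq_card.
    apply/fintype.subsetP => e; rewrite !inE => /andP[_ /forallP eB].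
    apply/familyP => i; rewrite /D; case: pickP => [a /eqP <-|//].
    by rewrite inE eB.
  (* As a product over the image, [2 ^ n.+1] supplies the factors 2 that [#|family D|] lacks. *)
  have -> : (2 ^ n.+1 = \prod_(i in codom (o p.1)) 2)%N.
    by rewrite prod_nat_const card_codom ?card_ord.
  rewrite card_family foldrE big_map big_enum /= [X in (_ * X)%N]big_mkcond -big_split /=.
  rewrite -prod_nat_const; apply: leq_prod => i _.
  rewrite /D; case: pickP => [a ai|ni]; first by rewrite card1 mul1n; case: ifP.
  case: ifP => [/codomP[a ia]|_]; last by rewrite muln1 card_bool.
  by have := ni a; rewrite ia eqxx.
have : (2 ^ #|I| <= \sum_p #|B p|)%N.
  rewrite -{1}card_bool -card_ffun -sum1_card.
  under [X in (_ <= X)%N]eq_bigr do rewrite -sum1_card big_mkcond.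
  rewrite exchange_big; apply: leq_sum => e _.
  by have [p pe] := HB e; rewrite (bigD1 p) //= [_ \in _]pe.
rewrite -(leq_pmul2r (expn_gt0 2 n.+1)) big_distrl /= leqNgt => /negP; apply.
apply: (@leq_ltn_trans (\sum_(p : 'I_N * bool) 2 ^ #|I|)); first exact: leq_sum.
rewrite sum_nat_const card_prod card_ord card_bool expnS.
by rewrite [X in (X < _)%N]mulnC ltn_pmul2l ?expn_gt0 // [X in (X < _)%N]mulnC ltn_pmul2l.
Qed.

(* Up to scaling, [n.+1] vectors in general position satisfy one linear
   relation, and none of its coefficients vanishes. *)
Lemma relation_signs (R : realType) n (u : 'I_n.+1 -> 'cV[R]_n) :
    (forall c : 'I_n.+1 -> R, (#|[pred i | c i != 0%R]| <= n)%N ->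
       \sum_i c i *: u i = 0 -> forall i, c i = 0) ->
  exists s : 'I_n.+1 -> bool, forall (e : 'I_n.+1 -> bool) (t : 'I_n.+1 -> R),
    (forall i, 0 <= t i) -> \sum_i t i *: ((-1) ^+ e i *: u i) = 0 ->
    (forall i, t i = 0) \/ exists b, forall i, e i = b (+) s i.
Proof.
move=> uP.
have small (c : 'I_n.+1 -> R) i : c i = 0 -> (#|[pred j | c j != 0%R]| <= n)%N.
  move=> ci; rewrite -ltnS -[in X in (_ < X)%N](card_ord n.+1); apply: proper_card.
  by apply/properP; split; [exact/fintype.subsetP|exists i; rewrite // !inE ci eqxx].
have [l l0 lu] : exists2 l : 'rV[R]_n.+1, l != 0 & \sum_i l 0 i *: u i = 0.
  pose A := \matrix_(i < n.+1, j < n) u i j 0.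
  have : kermx A != 0 by rewrite -mxrank_eq0 mxrank_ker subn_eq0 -ltnNge ltnS rank_leq_col.
  rewrite -nz_row_eq0; have /sub_kermxP := nz_row_sub (kermx A).
  move: (nz_row _) => l lA l0; exists l => //; apply/colP => j.
  have /rowP/(_ j) := lA; rewrite !mxE summxE => e; rewrite -[RHS]e.
  by apply: eq_bigr => i _; rewrite !mxE.
have ln0 i : l 0 i != 0.
  apply: contra l0 => /eqP li; apply/eqP/rowP => j; rewrite mxE.
  exact: (uP _ (small _ i li) lu).
exists (fun i => l 0 i < 0) => e t t0 tu.
(* Chosen so that the difference of the two relations vanishes at [ord0], hence has at most [n]
   nonzero coefficients. The sign of [m] will be [b]. *)
pose m := t ord0 * (-1) ^+ e ord0 / l 0 ord0.
have tl i : t i * (-1) ^+ e i = m * l 0 i.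
  apply/eqP; rewrite -subr_eq0; apply/eqP.
  apply: (uP (fun i => t i * (-1) ^+ e i - m * l 0 i)).
    by apply: (small _ ord0); rewrite /m divfK ?subrr.
  under eq_bigr do rewrite scalerBl -!scalerA.
  by rewrite big_split /= tu sumrN -!scaler_sumr lu !scaler0 oppr0 addr0.
have [m0|m0] := eqVneq m 0.
  left=> i; have /eqP := tl i; rewrite m0 mul0r mulf_eq0 signr_eq0 orbF => /eqP.
  by [].
right; exists (m < 0) => i.
have ti : 0 < t i.
  rewrite lt_def t0 andbT; apply/eqP => ti; have /esym/eqP := tl i.
  by rewrite ti mul0r mulf_eq0 (negPf m0) (negPf (ln0 i)).
by have := congr1 (fun x => x < 0) (tl i); rewrite /= pmulr_rlt0 // signr_lt0 mulr_lt0 m0 ln0.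
Qed.

(** * Orbits of vertices and of faces *)

Section Regroup.
Variables (R : realType) (I K : finType) (o : K -> I) (t : K -> R).

(** Vertices of a face with the same index will share their vector; regrouping by index gives the
    form that [general_position] handles. *)
Definition fiber_sum (i : I) : R := \sum_(a | o a == i) t a.

Lemma fiber_sumE n (v : K -> 'cV[R]_n) (w : I -> 'cV[R]_n) :
    (forall a, v a = w (o a)) ->
  \sum_a t a *: v a = \sum_i fiber_sum i *: w i.
Proof.
move=> vw; rewrite (partition_big o xpredT) //=; apply: eq_bigr => i _.
by rewrite scaler_suml; apply: eq_bigr => a /eqP <-; rewrite vw.
Qed.

Lemma fiber_sum_codom i : fiber_sum i != 0 -> i \in codom o.
Proof.
apply: contraNT => iN; rewrite /fiber_sum big_pred0 // => a.
by apply: contraNF iN => /eqP <-; exact: codom_f.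
Qed.

Lemma card_fiber_sum_codom : (#|[pred i | fiber_sum i != 0%R]| <= #|codom o|)%N.
Proof. by apply/subset_leq_card/fintype.subsetP => i /fiber_sum_codom. Qed.

Lemma card_fiber_sum :
  (#|[pred i | fiber_sum i != 0%R]| <= #|[pred a | t a != 0%R]|)%N.
Proof.
apply: leq_trans (leq_image_card o [pred a | t a != 0]).
apply/subset_leq_card/fintype.subsetP => i; rewrite inE; apply: contraNT => iN.
rewrite /fiber_sum big1 // => a /eqP ai; apply/eqP; apply: contraNT iN => ta.
by apply/fintype.imageP; exists a.
Qed.

Lemma fiber_sum_inj a : injective o -> fiber_sum (o a) = t a.
Proof.
move=> oI; rewrite /fiber_sum (big_pred1 a) // => b.
by apply/eqP/eqP => [/oI|->].
Qed.

Lemma fiber_sum_eq0 : (forall a, 0 <= t a) -> (forall i, fiber_sum i = 0) ->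
  forall a, t a = 0.
Proof. by move=> t0 H a; have /psumr_eq0P := H (o a); apply=> //; rewrite eqxx. Qed.

(** [general_position] allows one translation per index, so translations of vertices must factor
    through their indices. *)
Lemma common_translate (G : baseFinGroupType) (g : K -> G) :
    (forall a b, o a = o b -> g a = g b) ->
  exists h : I -> G, forall a, g a = h (o a).
Proof.
move=> og; exists (fun i => if [pick a | o a == i] is Some a then g a else 1%g) => a.
case: pickP => [b /eqP ob|/(_ a)]; last by rewrite eqxx.
exact: og.
Qed.

End Regroup.

Section OrbitSection.
Variables (R : realType) (gT : finGroupType) (X : sset) (a : simplicial_action gT X).

Lemma sactK g k (x : X k) : sact a g^-1 (sact a g x) = x.
Proof. by rewrite -sactM mulVg sact1. Qed.

Lemma nondegenerate_act g k (x : X k) : ~ degenerate x -> ~ degenerate (sact a g x).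
Proof.
move=> xN [m [f [y [mk fS e]]]]; apply: xN; exists m, f, (sact a g^-1 y); split=> //.
by rewrite -sact_map -e sactK.
Qed.

Lemma vertex_act g k (x : X k) i : vertex (sact a g x) i = sact a g (vertex x i).
Proof. by rewrite /vertex sact_map. Qed.

Hypothesis free : forall (k : nat) (s : X k) (g : gT), faces X k s -> g != 1%g ->
  closed_face R s `&` (realization_act a g @` closed_face R s) = set0.

(** The vertex gives a point common to the closed face of [x] and its translate by [g]. *)
Lemma face_vertex_free k (x : X k) i j g : faces X k x ->
  vertex x i = sact a g (vertex x j) -> g = 1%g.
Proof.
move=> xN e; apply/eqP; apply: contrapT => /negP g1.
have t1 : stdsimplex R 0 (const_mx 1).
  by split=> [l|]; rewrite ?big_ord1 mxE ?ler01.
pose t : stdsimplex R 0 := SigSub (mem_set t1).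
have := free xN g1; apply/eqP/set0P; exists (char_map (vertex x i) t); split.
  by rewrite /vertex char_map_glue; exact: imageT.
rewrite e -realization_act_char; exists (char_map (vertex x j) t) => //.
by rewrite /vertex char_map_glue; exact: imageT.
Qed.

Lemma vertex_free (v : X 0) g h : sact a g v = sact a h v -> g = h.
Proof.
move=> e; suff : (h^-1 * g)%g = 1%g by move/(congr1 (mulg h)); rewrite mulKVg mulg1.
apply: (@face_vertex_free 0 v ord0 ord0); first by move=> [m [f [z []]]].
by rewrite vertex0 sactM e sactK.
Qed.

Definition same_orbit (v u : X 0) : bool := `[< exists g, u = sact a g v >].

Lemma same_orbit_act g v : same_orbit (sact a g v) = same_orbit v.
Proof.
apply/funext => u; apply/asboolP/asboolP => -[h ->].
  by exists (h * g)%g; rewrite sactM.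
by exists (h * g^-1)%g; rewrite sactM sactK.
Qed.

(** [choose] returns the same element from any two starting points that satisfy the predicate, so
    the representative is constant on orbits. *)
Definition orbit_rep (v : X 0) : X 0 := choose (same_orbit v) v.

Lemma orbit_rep_act g v : orbit_rep (sact a g v) = orbit_rep v.
Proof.
rewrite /orbit_rep same_orbit_act; apply: choose_id; apply/asboolP.
  by exists g.
by exists 1%g; rewrite sact1.
Qed.

(** The default is never taken, by [translationP]. Freeness makes the group element unique, and
    therefore equivariant in [v]. *)
Definition translation (v : X 0) : gT :=
  odflt 1%g [pick g | v == sact a g (orbit_rep v)].

Lemma translationP v : v = sact a (translation v) (orbit_rep v).
Proof.
rewrite /translation; case: pickP => [g /eqP//|H].
have /asboolP[g gv] : same_orbit v (orbit_rep v).
  by apply: chooseP; apply/asboolP; exists 1%g; rewrite sact1.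
by have := H g^-1%g; rewrite gv sactK eqxx.
Qed.

Lemma translation_act g v : translation (sact a g v) = (g * translation v)%g.
Proof.
apply: (@vertex_free (orbit_rep v)).
by rewrite sactM -translationP -(orbit_rep_act g v) -translationP.
Qed.

End OrbitSection.

(** An infinite set of orbits would receive an injection from [nat], so there are finitely many
    orbits, and fewer than [M]. *)
Lemma face_orbit_reps (gT : finGroupType) (X : sset) (a : simplicial_action gT X) n M :
    ~~ (`I_M #<= face_orbits a n) ->
  exists N (xs : 'I_N -> X n), [/\ (N < M)%N, forall j, faces X n (xs j) &
    forall y, faces X n y -> exists j g, y = sact a g (xs j)].
Proof.
move=> small.
have /finite_setP[N AN] : finite_set (face_orbits a n).
  apply/finite_setPn => H; move/negP: small; apply.
  exact: card_le_trans (card_leT _) H.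
exists N; have NM : (N < M)%N.
  rewrite ltnNge; apply: contra small => MN.
  by rewrite (card_le_eqr AN) card_le_II.
have /card_set_bijP[f [fA _ fS]] := card_esym AN.
have /choice[xs xsP] (j : 'I_N) : exists x, faces X n x /\ simplex_orbit a x = f j.
  by have [x xF <-] := fA j (ltn_ord j); exists x.
exists xs; split=> // [j|y yF]; first by have [] := xsP j.
have [j jN fj] := fS (simplex_orbit a y) (imageP _ yF).
have [_ e] := xsP (Ordinal jN).
have : simplex_orbit a y y by exists 1%g; rewrite // sact1.
by rewrite -fj -e => -[g _ <-]; exists (Ordinal jN), g.
Qed.

(** * The equivariant map *)

Section EquivariantMap.
Variables (R : realType) (gT : finGroupType) (n N : nat).
Variables (rV : mx_representation R [set: gT]%G n).
Variables (X : sset) (a : simplicial_action gT X).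
Hypothesis dimX : sset_dim_le X n.
Hypothesis free : forall (k : nat) (s : X k) (g : gT), faces X k s -> g != 1%g ->
  closed_face R s `&` (realization_act a g @` closed_face R s) = set0.
Variable xs : 'I_N -> X n.
Hypothesis xs_face : forall j, faces X n (xs j).
Hypothesis xs_orbit : forall y, faces X n y -> exists j g, y = sact a g (xs j).

(* [inl] indexes the vertices of the representatives of the [n]-faces,
   [inr] the dimensions of the remaining faces. *)
Definition vector_index : finType := ('I_N * 'I_n.+1 + 'I_n.+1)%type.

(** The value [inr ord0] goes to the vertices that lie on no [n]-face. *)
Definition vertex_index (v : X 0) : vector_index :=
  if [pick p : 'I_N * 'I_n.+1 | same_orbit a v (vertex (xs p.1) p.2)] is Some p
  then inl p else inr ord0.

Lemma vertex_index_act g v : vertex_index (sact a g v) = vertex_index v.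
Proof. by rewrite /vertex_index same_orbit_act. Qed.

(** The subcomplex generated by the [n]-faces, degenerate simplices included. *)
Definition in_top k (x : X k) : Prop :=
  exists j g (f : 'Delta(k, n)), x = sact a g (sset_map f (xs j)).

Lemma in_top_map l m (f : 'Delta(l, m)) (x : X m) : in_top x -> in_top (sset_map f x).
Proof.
move=> [j [g [h ->]]]; exists j, g, (Dcomp h f).
by rewrite -sact_map sset_mapM.
Qed.

Lemma in_top_act g k (x : X k) : in_top x -> in_top (sact a g x).
Proof. by move=> [j [h [f ->]]]; exists j, (g * h)%g, f; rewrite sactM. Qed.

Lemma in_top_actE g k (x : X k) : in_top (sact a g x) <-> in_top x.
Proof.
split; last exact: in_top_act.
by move/(in_top_act g^-1); rewrite sactK.
Qed.

Lemma in_top_face y : faces X n y -> in_top y.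
Proof.
by move=> /xs_orbit[j [g ->]]; exists j, g, (Did n); rewrite sset_map1.
Qed.

(** Equal indices put two vertices of an [n]-face in one orbit, and freeness then makes them
    equal. *)
Lemma vertex_index_in_top k (x : X k) i j : in_top x ->
  vertex_index (vertex x i) = vertex_index (vertex x j) -> vertex x i = vertex x j.
Proof.
move=> [l [g [f ->]]]; rewrite !vertex_act !vertex_index_act !vertex_map.
move: (f i) (f j) => {}i {}j; rewrite /vertex_index.
case: pickP => [p /asboolP[h pi]|/(_ (l, i))/asboolP[]]; last first.
  by exists 1%g; rewrite sact1.
case: pickP => [q /asboolP[h' qj] [pq]|/(_ (l, j))/asboolP[]]; last first.
  by exists 1%g; rewrite sact1.
have e : vertex (xs l) i = sact a (h^-1 * h') (vertex (xs l) j).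
  by rewrite sactM -qj -pq pi sactK.
by rewrite e (face_vertex_free free (@xs_face l) e) sact1.
Qed.

Variable w : vector_index -> 'cV[R]_n.

Definition vertex_value (v : X 0) : 'cV[R]_n :=
  rV (translation a v) *m w (vertex_index v).

Lemma rV_mul g h (v : 'cV[R]_n) : rV (g * h)%g *m v = rV g *m (rV h *m v).
Proof. by rewrite repr_mxM ?inE // mulmxA. Qed.

Lemma vertex_value_act g v : vertex_value (sact a g v) = rV g *m vertex_value v.
Proof. by rewrite /vertex_value vertex_index_act (translation_act free) rV_mul. Qed.

(** The sum of vertex values makes the map affine on the subcomplex. Elsewhere the translation of
    the first vertex gives equivariance; [inord k] is faithful for [k <= n], which covers the
    dimensions of all faces. *)
Definition apex k (x : X k) : 'cV[R]_n :=
  if `[< in_top x >] then \sum_i vertex_value (vertex x i)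
  else rV (translation a (vertex x ord0)) *m w (inr (inord k)).

Lemma apex_act g k (x : X k) : rV g *m apex x = apex (sact a g x).
Proof.
rewrite /apex (asbool_equiv_eq (in_top_actE g x)); case: ifP => _.
  by rewrite mulmx_sumr; apply: eq_bigr => i _; rewrite vertex_act vertex_value_act.
by rewrite vertex_act (translation_act free) rV_mul.
Qed.

Lemma cone_map_act g k (x : X k) u :
  rV g *m cone_map apex x u = cone_map apex (sact a g x) u.
Proof.
apply: (@cone_map_morph R X _ _ apex apex (sact a g) (mulmx (rV g))).
- by move=> l m f y; rewrite sact_map.
- by move=> m y; exact: nondegenerate_act.
- exact: apex_act.
Qed.

Lemma realization_map_equivariant : equivariant a rV (realization_map apex).
Proof.
move=> g p; have -> : p = char_map (tagged (tag (repr p))) (tagged (repr p)).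
  rewrite -[p in LHS]reprK; case: (repr p) => -[k x] t.
  by [].
by rewrite realization_act_char !realization_map_char cone_map_act.
Qed.

Lemma cone_map_in_top k (x : X k) u : in_top x ->
  cone_map apex x u = \sum_i u i *: vertex_value (vertex x i).
Proof.
apply: (@cone_map_affine R X _ apex in_top).
  by move=> l m f y; exact: in_top_map.
by move=> m y yY; rewrite /apex (asboolT yY).
Qed.

(** This brings the value into the form of [general_position]; each coning adds one vector. The
    bound on [l] is an invariant of the induction: it shows that the vector of a new apex is not yet
    in use. *)
Lemma cone_map_indices k (x : X k) u : (k <= n)%N -> (forall i, 0 <= u i) ->
  exists (c : vector_index -> R) (g : vector_index -> gT),
  [/\ cone_map apex x u = \sum_i c i *: (rV (g i) *m w i),
      (#|[pred i | c i != 0%R]| <= k.+1)%N,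
      forall l : 'I_n.+1, c (inr l) != 0 -> (l <= k)%N &
      (forall i, c i = 0) -> forall i, u i = 0].
Proof.
elim/ltn_ind: k x u => k IH x u kn u0; have [xY|xY] := pselect (in_top x).
  pose o i := vertex_index (vertex x i).
  have [g gE] : exists g : vector_index -> gT, forall i, translation a (vertex x i) = g (o i).
    by apply: common_translate => i j /(vertex_index_in_top xY) ->.
  exists (fiber_sum o u), g; split.
  - rewrite cone_map_in_top //; apply: fiber_sumE => i.
    by rewrite /vertex_value gE.
  - apply: leq_trans (card_fiber_sum_codom o u) _.
    by rewrite -[X in (_ <= X)%N]card_ord; exact: leq_image_card.
  (* The only [inr] index that a vertex can have is [inr ord0], which meets the bound. *)
  - move=> l /fiber_sum_codom/codomP[i]; rewrite /o /vertex_index.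
    by case: pickP => [p _ //|_ [->]].
  - exact: fiber_sum_eq0.
have [m [s [y [mk sS yN xe]]]] := ez_exists x.
have yY : ~ in_top y by move=> yY; apply: xY; rewrite xe; exact: in_top_map.
suff : exists (c : vector_index -> R) (g : vector_index -> gT),
  [/\ cone_map apex y (push s u) = \sum_i c i *: (rV (g i) *m w i),
      (#|[pred i | c i != 0%R]| <= m.+1)%N,
      forall l : 'I_n.+1, c (inr l) != 0 -> (l <= m)%N &
      (forall i, c i = 0) -> forall i, push s u i = 0].
  move=> [c [g [cE cn cl c0]]]; exists c, g; split=> //.
  - by rewrite xe cone_map_surj.
  - exact: leq_trans cn _.
  - by move=> l /cl lm; exact: leq_trans lm mk.
  - by move=> /c0 H; exact: push_eq0 H.
have v0 i : 0 <= push s u i by exact: push_ge0.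
move: (push s u) v0 => v v0 {x xe xY u u0 s sS}.
have apexE : apex y = rV (translation a (vertex y ord0)) *m w (inr (inord m)).
  by rewrite /apex asboolF.
set g1 := translation _ _ in apexE; set k1 : vector_index := inr _ in apexE.
have mn : (m < n.+1)%N by lia.
have k1E : k1 = inr (inord m) by [].
move: g1 k1 apexE k1E => g1 k1.
case: m y yN yY v v0 mk mn => [|m] y yN yY v v0 mk mn apexE k1E.
  exists (fun i => if i == k1 then v ord0 else 0), (fun=> g1); split.
  - rewrite cone_map_vertex apexE (bigD1 k1) //= eqxx big1 ?addr0 // => i /negPf ->.
    by rewrite scale0r.
  - rewrite -(card1 k1); apply/subset_leq_card/fintype.subsetP => i; rewrite !inE.
    by case: (i =P k1) => //; rewrite eqxx.
  - move=> l; case: (inr l =P k1); last by rewrite eqxx.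
    by rewrite k1E => -[->] _; rewrite inordK.
  - by move=> /(_ k1); rewrite eqxx => v00 i; rewrite ord1.
pose b := argmin v.
have vb j : 0 <= v (lift b j) - v b by rewrite subr_ge0 argminP.
have [|c [g [cE cn cl c0]]] := IH m mk (sset_map (coface b) y) _ _ vb; first lia.
(* The facet uses apex indices up to [m] only, while [k1] stands for dimension [m.+1]. *)
have ck : c k1 = 0.
  by apply/eqP; apply: contraT; rewrite k1E => /cl; rewrite inordK // ltnn.
exists (fun i => if i == k1 then v b else c i), (fun i => if i == k1 then g1 else g i); split.
- rewrite (@cone_map_min _ _ _ _ _ _ _ b) //; last by move=> j; exact: argminP.
  rewrite cE apexE (bigD1 k1) //= ck scale0r add0r [RHS](bigD1 k1) //= eqxx.
  by congr (_ + _); apply: eq_bigr => i /negPf ->.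
- apply: (@leq_trans (#|[predU1 k1 & [pred i | c i != 0]]|)); last first.
    by rewrite cardU1 inE ck eqxx /= add1n.
  by apply/subset_leq_card/fintype.subsetP => i; rewrite !inE; case: (i =P k1).
- move=> l; case: (inr l =P k1) => [|_ /cl]; last exact: leqW.
  by rewrite k1E => -[->] _; rewrite inordK.
- move=> H; have vb0 : v b = 0 by have := H k1; rewrite eqxx.
  have {}c0 := c0 _; move=> j; case: (unliftP b j) => [i ->|->//].
  have := c0 _ i; rewrite vb0 subr0; apply=> i'.
  by have := H i'; case: (i' =P k1) => [->|].
Qed.

Hypothesis w_gp : general_position rV w.
Hypothesis w_top : forall j (t : 'I_n.+1 -> R), (forall i, 0 <= t i) ->
  \sum_i t i *: vertex_value (vertex (xs j) i) = 0 -> forall i, t i = 0.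

(** A face of dimension less than [n] involves at most [n] vectors, so general position suffices; an
    [n]-face is a translate of some [xs j], to which [w_top] applies. *)
Lemma cone_map_neq0 k (x : X k) u : (forall i, 0 <= u i) ->
  cone_map apex x u = 0 -> forall i, u i = 0.
Proof.
have [m [s [y [mk sS yN ->]]]] := ez_exists x => u0.
rewrite cone_map_surj // => e; apply: (push_eq0 (f := s) u0) => {mk sS}.
have := push_ge0 s u0; move: (push s u) e => {}u e {}u0 {x k s}.
have mn : (m <= n)%N.
  rewrite leqNgt; apply/negP => /dimX/seteqP[+ _] => /(_ y yN).
  by [].
move: mn; rewrite leq_eqVlt => /orP[/eqP mn|mn].
  subst m; have [j [g ye]] := xs_orbit yN.
  apply: (w_top (j := j)) => //; rewrite -cone_map_in_top; last exact: in_top_face.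
  have gu : rV g \in unitmx by apply: repr_mx_unit; rewrite inE.
  by rewrite -(mulKmx gu (cone_map _ _ _)) cone_map_act -ye e mulmx0.
have [c [g [cE cn _ c0]]] := cone_map_indices y (ltnW mn) u0.
apply: c0; apply: (w_gp (g := g)); last by rewrite -cE.
exact: leq_trans cn mn.
Qed.

Lemma realization_map_neq0 p : realization_map apex p <> 0.
Proof.
have -> : p = char_map (tagged (tag (repr p))) (tagged (repr p)).
  by rewrite -[p in LHS]reprK; case: (repr p) => -[k x] t.
move: (tagged (repr p)) => t; rewrite realization_map_char.
move=> /cone_map_neq0 H; have [t0 t1] := set_valP t.
have := t1; rewrite big1 => [/esym/eqP|i _]; first by rewrite oner_eq0.
exact: H.
Qed.

End EquivariantMap.

(** * Choice of the signs and conclusion *)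

Theorem theorem1p1 (R : realType) (gT : finGroupType) (n : nat)
    (rV : mx_representation R [set: gT]%G n)
    (X : sset) (a : simplicial_action gT X)
    (dimX : sset_dim_le X n)
    (free : forall (k : nat) (s : X k) (g : gT), faces X k s -> g != 1%g ->
      closed_face R s `&` (realization_act a g @` closed_face R s) = set0)
    (zero : forall f : realization R X -> 'cV[R]_n,
      continuous f -> equivariant a rV f -> exists p, f p = 0) :
  `I_(2 ^ n) #<= face_orbits a n.
Proof.
apply: contrapT => /negP /face_orbit_reps[N [xs [Nn xsF xsO]]].
pose I := vector_index n N.
have [w0 w0P] := general_position_exists rV I.
pose o j i : I := vertex_index a xs (vertex (xs j) i).
pose u j i := rV (translation a (vertex (xs j) i)) *m w0 (o j i).
have common j : exists g : I -> gT, forall i, translation a (vertex (xs j) i) = g (o j i).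
  apply: common_translate => i i' /(vertex_index_in_top free xsF) -> //.
  exact: in_top_face.
have /choice[s sP] (j : 'I_N) : exists s : 'I_n.+1 -> bool, injective (o j) ->
    forall (e : 'I_n.+1 -> bool) (t : 'I_n.+1 -> R),
    (forall i, 0 <= t i) -> \sum_i t i *: ((-1) ^+ e i *: u j i) = 0 ->
    (forall i, t i = 0) \/ exists b, forall i, e i = b (+) s i.
  (* When two vertices share an index, any signs will do, so [s] is arbitrary. *)
  have [oI|nI] := pselect (injective (o j)); last by exists (fun=> false) => /nI.
  have [|s sP] := @relation_signs R n (u j); last by exists s.
  have [g gE] := common j => c cn cu i.
  rewrite -(fiber_sum_inj c i oI); apply: (w0P g).
    exact: leq_trans (card_fiber_sum _ _) cn.
  by rewrite -[RHS]cu; apply/esym/fiber_sumE => l; rewrite /u gE.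
(* [e] avoids both sign patterns, [s j] and its opposite, that could put 0 in the image of an
   [n]-face with distinct indices. *)
have [e eP] := signs_union_bound o s Nn.
pose w i := (-1) ^+ e i *: w0 i.
have wP : general_position rV w by apply: general_position_sign.
have top j (t : 'I_n.+1 -> R) : (forall i, 0 <= t i) ->
    \sum_i t i *: vertex_value rV a xs w (vertex (xs j) i) = 0 -> forall i, t i = 0.
  move=> t0 tu; have [oI|nI] := boolP (injectiveb (o j)).
    move/injectiveP : oI => oI.
    have [|//|[b eb]] := sP j oI (fun i => e (o j i)) t t0; last by have := eP j b oI.
    by rewrite -[RHS]tu; apply: eq_bigr => i _; rewrite /vertex_value /w -scalemxAr.
  (* Here at most [n] indices occur, so general position already excludes 0. *)
  have [g gE] := common j; apply: (fiber_sum_eq0 (o := o j)) => //; apply: (wP g).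
    apply: leq_trans (card_fiber_sum_codom _ _) _.
    rewrite -ltnS -[X in (_ < X)%N](card_ord n.+1) ltn_neqAle leq_image_card andbT.
    by apply: contra nI => /image_injP oI; apply/injectiveP => i l; apply: oI.
  by rewrite -[RHS]tu; apply/esym/fiber_sumE => l; rewrite /vertex_value gE.
have [p p0] := zero _ (@realization_map_continuous _ _ _ (apex rV a xs w))
  (realization_map_equivariant rV free xs w).
exact: (@realization_map_neq0 _ _ _ _ rV _ _ dimX free _ xsF xsO w wP top p p0).
Qed.
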